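(* Let $u,v\in\mathbb{R}^2$ be linearly independent unit vectors with angle $2\beta\in(0,\pi)$ between them, let $c_u\neq0$ and $c_v>0$ be real constants, and let $T_wf$ be the weighted V-line transform of $f\in C_c(\mathbb{R}^2)$ with weights $c_u,c_v$. Let $$\widetilde\alpha=(\widetilde\alpha_x,\widetilde\alpha_y)=\frac{c_uv+c_vu}{\|c_uv+c_vu\|}.$$ Then, for every $(x,y)\in\mathbb{R}^2$, $$f(x,y)=\frac{1}{\|c_uv+c_vu\|}\,\frac{\partial}{\partial u}\frac{\partial}{\partial v}\int_0^\infty (T_wf)(x+\widetilde\alpha_xt,\,y+\widetilde\alpha_yt)\,dt .$$ The coefficient can be expressed as $$\frac{1}{\|c_uv+c_vu\|}=\frac{\sin\beta_1}{c_v\sin(2\beta)},$$ where $\beta_1\in(0,\pi)$ is the angle determined, together with $\beta_2$ satisfying $|\beta_2|\in(0,\pi)$, by $\beta_1+\beta_2=2\beta$ and $\frac{\sin\beta_1}{\sin\beta_2}=\frac{c_v}{c_u}$.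
   Context: For $(x,y)\in\mathbb{R}^2$ and a unit vector $w$, $R_w(x,y)=\{(x,y)+tw:t\ge0\}$. The weighted V-line transform is $(T_wf)(x,y)=c_v\int_{R_v(x,y)}f\,dl+c_u\int_{R_u(x,y)}f\,dl$, where $dl$ is the one-dimensional Lebesgue measure. $\frac{\partial}{\partial u},\frac{\partial}{\partial v}$ are directional derivatives. *)

(* Defs.v *)
From mathcomp Require Import all_boot all_order all_algebra.
From mathcomp Require Import all_classical all_reals all_analysis.

Set Implicit Arguments.
Unset Strict Implicit.
Unset Printing Implicit Defensive.

Import Order.TTheory GRing.Theory Num.Theory numFieldNormedType.Exports.

Local Open Scope classical_set_scope.
Local Open Scope ring_scope.

(* The library norm `|_| on 'rV[R]_2 is the sup norm; enorm is the Euclidean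
   one. Both induce the same topology. *)
Definition dotv (R : realType) (u v : 'rV[R]_2) : R := \sum_(i < 2) u 0 i * v 0 i.

Definition enorm (R : realType) (u : 'rV[R]_2) : R := Num.sqrt (dotv u u).

Definition angle (R : realType) (u v : 'rV[R]_2) : R :=
  acos (dotv u v / (enorm u * enorm v)).

Definition compactly_supported (R : realType) (f : 'rV[R]_2 -> R) : Prop :=
  compact (closure [set p | f p != 0]).

(* When w is a unit vector, t |-> p + t w is the arc-length parametrization of
   the ray with vertex p and direction w, so this is the integral of f over the
   ray against its one-dimensional Lebesgue measure. *)
Definition ray_integral (R : realType) (f : 'rV[R]_2 -> R) (w p : 'rV[R]_2) : R :=
  \int[lebesgue_measure]_(t in `[0, +oo[) f (p + t *: w).

Definition weighted_vline (R : realType) (u v : 'rV[R]_2) (cu cv : R)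
    (f : 'rV[R]_2 -> R) (p : 'rV[R]_2) : R :=
  cv * ray_integral f v p + cu * ray_integral f u p.

Definition weighted_sum (R : realType) (u v : 'rV[R]_2) (cu cv : R) : 'rV[R]_2 :=
  cu *: v + cv *: u.

Definition weighted_axis (R : realType) (u v : 'rV[R]_2) (cu cv : R) : 'rV[R]_2 :=
  (enorm (weighted_sum u v cu cv))^-1 *: weighted_sum u v cu cv.

Definition splits_angle (R : realType) (beta cu cv : R) (b : R * R) : Prop :=
  [/\ 0 < b.1 < pi, 0 < `|b.2| < pi, b.1 + b.2 = 2 * beta
    & sin b.1 / sin b.2 = cv / cu].

(* Main.v *)
Require Import Defs.
From mathcomp Require Import all_boot all_order all_algebra.
From mathcomp Require Import all_classical all_reals all_analysis.
From mathcomp Require Import ring lra.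

(** Write G_w for the ray integral of f in the direction w, T for the weighted
V-line transform, N for the norm of cu v + cv u, alpha for the unit vector
(cu v + cv u) / N, and set

  F p = int_0^oo T (p + t alpha) dt,    Q p = int_0^oo G_u (p + s v) ds,

so that Q is the integral of f over the sector with vertex p spanned by u and
v, up to the Jacobian.  The key identity is F = N Q.  It says that the two
sectors spanned by alpha with u and by alpha with v, counted with their weights,
add up to the sector spanned by u and v; when cu < 0 the first one is subtracted.
Once it is known, the inversion formula is twice the fundamental theorem of
calculus along a ray, D_v F = - N G_u and D_u G_u = - f.

The identity is obtained without change of variables or Fubini's theorem, and
without a case analysis on the sign of cu: both sides have the same derivative
along alpha, and both vanish far out in the direction alpha.
- D_alpha F = - T (is_derive_along_ray).
- D_v Q = - G_u by the same lemma, and D_u Q = - G_v by differentiation under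
  the integral sign (is_derive_under_ray).  Since D_v Q is continuous, the two
  combine into N D_alpha Q = - cv G_v - cu G_u = - T (is_derive_combination).
- The coordinate along u does not decrease along u and v and it increases along
  alpha, because cv > 0.  As f vanishes where this coordinate is large, so do
  T, F and Q.
A function that is constant along alpha and vanishes far out is zero
(eq0_of_derive0).

For the coefficient, N^2 = K^2 + S^2 where K = cu + cv cos (2 beta) and
S = cv sin (2 beta) > 0.  The equation for beta_1 and beta_2 amounts to
K sin beta_1 = S cos beta_1, so that (K, S) has polar coordinates (N, beta_1).
This determines beta_1 in the interval from 0 to pi and gives
N sin beta_1 = S. *)

Import Order.TTheory GRing.Theory Num.Theory numFieldNormedType.Exports.

Local Open Scope classical_set_scope.
Local Open Scope ring_scope.

Set Implicit Arguments.
Unset Strict Implicit.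
Unset Printing Implicit Defensive.

(** * Continuity along segments and integrals over them *)

(** A compact segment is covered by finitely many of the neighbourhoods that
continuity of g provides, so one neighbourhood of p works for all t.  This is what
allows limits to be taken under the integral sign. *)
Lemma near_ray_uniform {R : realType} (g : 'rV[R]_2 -> R) (w p : 'rV[R]_2)
    (L eps : R) : continuous g -> 0 < eps ->
  \forall q \near p, forall t, t \in `[0, L] ->
    `|g (q + t *: w) - g (p + t *: w)| <= eps.
Proof.
move=> cg e0.
have /compact_near_coveringP cov := @segment_compact R 0 L.
have := cov _ (nbhs p)
  (fun q t => `|g (q + t *: w) - g (p + t *: w)| <= eps) _ _.
move=> H; have {}H : \forall q \near p, [set` `[0, L]] `<=`
    (fun t => `|g (q + t *: w) - g (p + t *: w)| <= eps).
  apply: H => x _.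
  have e2 : 0 < eps / 2 by rewrite divr_gt0.
  have c1 : g (z.2 + z.1 *: w) @[z --> (x, p)] --> g (p + x *: w).
    apply: (@cvg_comp _ _ _ (fun z : R * 'rV[R]_2 => z.2 + z.1 *: w) g _ (nbhs (p + x *: w))); last exact: cg.
    by apply: cvgD; [exact: cvg_snd | apply: cvgZr_tmp; exact: cvg_fst].
  have c2 : g (p + z.1 *: w) @[z --> (x, p)] --> g (p + x *: w).
    apply: (@cvg_comp _ _ _ (fun z : R * 'rV[R]_2 => p + z.1 *: w) g _ (nbhs (p + x *: w))); last exact: cg.
    by apply: cvgD; [exact: cvg_cst | apply: cvgZr_tmp; exact: cvg_fst].
  move/cvgrPdist_le : c1 => /(_ _ e2) c1.
  move/cvgrPdist_le : c2 => /(_ _ e2) c2.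
  near=> z.
  have h1 : `|g (p + x *: w) - g (z.2 + z.1 *: w)| <= eps / 2 by near: z; exact: c1.
  have h2 : `|g (p + x *: w) - g (p + z.1 *: w)| <= eps / 2 by near: z; exact: c2.
  rewrite (splitr eps) (le_trans _ (lerD h1 h2))//.
  rewrite (distrC (g (p + x *: w)) (g (z.2 + z.1 *: w))).
  by rewrite (le_trans _ (ler_normD _ _))// addrA subrK.
apply: filterS H => q Hq t tL; exact: Hq.
Unshelve. all: by end_near. Qed.

Lemma continuous_along_ray {R : realType} (g : 'rV[R]_2 -> R) (p w : 'rV[R]_2) :
  continuous g -> continuous (fun t : R => g (p + t *: w)).
Proof.
move=> cg t.
apply: (@cvg_comp _ _ _ (fun z : R => p + z *: w) g _ (nbhs (p + t *: w)));
  last exact: cg.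
by apply: cvgD; [exact: cvg_cst | apply: cvgZr_tmp; exact: cvg_id].
Qed.

Lemma continuous_integrable_segment {R : realType} (phi : R -> R) (a b : R) :
  continuous phi -> lebesgue_measure.-integrable `[a, b] (EFin \o phi).
Proof.
move=> cphi; apply: continuous_compact_integrable; first exact: segment_compact.
exact: continuous_subspaceT.
Qed.

Lemma dist_Rintegral_segment {R : realType} (a b : R -> R) (L eps : R) :
  continuous a -> continuous b -> 0 <= L ->
  (forall t, t \in `[0, L] -> `|a t - b t| <= eps) ->
  `|\int[lebesgue_measure]_(t in `[0, L]) a t
    - \int[lebesgue_measure]_(t in `[0, L]) b t| <= eps * L.
Proof.
move=> ca cb L0 ab.
have cab : continuous (fun t => a t - b t).
  by move=> t; apply: cvgB; [exact: ca | exact: cb].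
have cnab : continuous (fun t => `|a t - b t|).
  by move=> t; apply: cvg_norm; exact: cab.
rewrite -RintegralB//; try exact: continuous_integrable_segment.
apply: (le_trans (le_normr_Rintegral _ _)) => //;
  first exact: continuous_integrable_segment.
rewrite (@le_trans _ _ (\int[lebesgue_measure]_(t in `[0, L]) cst eps t))//.
  apply: le_Rintegral => //; try apply: continuous_integrable_segment => //.
  by move=> t; exact: cvg_cst.
rewrite Rintegral_cst//=.
have -> : fine (lebesgue_measure (`[0, L]%classic : set R)) = L; last by [].
rewrite lebesgue_measure_itv/= lte_fin.
have [L1|] := ltP 0 L; first by rewrite -EFinB/= subr0.
by rewrite le_eqVlt ltNge L0 orbF => /eqP ->.
Qed.

(** * Directional derivatives *)

(** Brings in the one-dimensional calculus: the mean value theorem, the chain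
rule and the fundamental theorem of calculus. *)
Lemma is_derive_line {R : realType} (F : 'rV[R]_2 -> R) (p v : 'rV[R]_2) (l : R) :
  is_derive p v F l <-> is_derive (0 : R) 1 (fun h : R => F (p + h *: v)) l.
Proof.
have E : (fun h : R => h^-1 *: ((F \o shift p) (h *: v) - F p)) =
  (fun h : R => h^-1 *: (((fun h : R => F (p + h *: v)) \o shift 0) (h *: (1:R))
     - F (p + 0 *: v))).
  by apply/funext => h /=; rewrite addr0 scale0r addr0 [h%:A]mulr1 (addrC p).
by split=> -[d1 d2]; apply: DeriveDef; move: d1 d2; rewrite /derivable /derive E.
Qed.

Lemma cvg_is_derive {R : realType} (F : 'rV[R]_2 -> R) (p v : 'rV[R]_2) (l : R) :
  h^-1 * (F (p + h *: v) - F p) @[h --> 0^'] --> l -> is_derive p v F l.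
Proof.
have -> : (fun h : R => h^-1 * (F (p + h *: v) - F p)) =
   (fun h : R => h^-1 *: ((F \o shift p) (h *: v) - F p)).
  by apply/funext => h /=; rewrite (addrC p).
by move=> H; apply: DeriveDef; [apply/cvg_ex; exists l|exact: cvg_lim].
Qed.

Lemma is_derive_line_at {R : realType} (F : 'rV[R]_2 -> R) (p v : 'rV[R]_2) (t l : R) :
  is_derive (p + t *: v) v F l -> is_derive t 1 (fun h : R => F (p + h *: v)) l.
Proof.
move=> /is_derive_line H.
have E : (fun h : R => h^-1 *: (((fun h : R => F (p + h *: v)) \o shift t) (h *: (1:R)) - F (p + t *: v))) =
  (fun h : R => h^-1 *: (((fun h : R => F (p + t *: v + h *: v)) \o shift 0) (h *: (1:R))
     - F (p + t *: v + 0 *: v))).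
  apply/funext => h /=; rewrite addr0 scale0r addr0.
  by rewrite -(addrA p) -scalerDl (addrC t).
by case: H => d1 d2; apply: DeriveDef; move: d1 d2; rewrite /derivable /derive E.
Qed.

(** Real t of either sign is allowed, whence the bound on |xi| in place of an
interval. *)
Lemma directional_MVT {R : realType} (q g : 'rV[R]_2 -> R) (p v : 'rV[R]_2) (t : R) :
  (forall p, is_derive p v q (g p)) ->
  exists2 xi : R, `|xi| <= `|t| & q (p + t *: v) - q p = t * g (p + xi *: v).
Proof.
move=> dq.
have dl (x : R) : is_derive x 1 (fun h : R => q (p + h *: v)) (g (p + x *: v)).
  exact: is_derive_line_at.
have cl (a b : R) : {within `[a, b], continuous (fun h : R => q (p + h *: v))}.
  apply: derivable_within_continuous => x _.
  by have [] := dl x.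
have [t0|t0] := leP 0 t.
  have [c ct E] := @MVT_segment R (fun h : R => q (p + h *: v)) (fun x : R => g (p + x *: v)) 0 t t0
    (fun x _ => dl x) (cl _ _).
  exists c; first by move: ct; rewrite in_itv/= => /andP[c0 ct]; rewrite !ger0_norm.
  by move: E; rewrite scale0r addr0 subr0 mulrC.
have [c ct E] := @MVT_segment R (fun h : R => q (p + h *: v)) (fun x : R => g (p + x *: v)) t 0 (ltW t0)
  (fun x _ => dl x) (cl _ _).
exists c.
  by move: ct; rewrite in_itv/= => /andP[c0 ct]; rewrite !ler0_norm ?(ltW t0)// lerN2.
move: E; rewrite scale0r addr0 sub0r mulrN mulrC => E.
by rewrite -opprB E opprK.
Qed.

Lemma dotvE {R : realType} (u v : 'rV[R]_2) :
  dotv u v = u 0 0 * v 0 0 + u 0 1 * v 0 1.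
Proof.
rewrite /dotv !big_ord_recl big_ord0 addr0.
by rewrite (_ : lift ord0 ord0 = 1)//; apply/val_inj.
Qed.

(** Vanishing on an open half-plane is what remains of compact support: unlike
compact support itself it is inherited by ray integrals. *)
Definition vanishes_past {R : realType} (m : 'rV[R]_2) (B : R) (g : 'rV[R]_2 -> R) :=
  forall q, B < dotv m q -> g q = 0.

Lemma dotvDZ {R : realType} (m p w : 'rV[R]_2) (t : R) :
  dotv m (p + t *: w) = dotv m p + t * dotv m w.
Proof. by rewrite !dotvE !mxE; ring. Qed.

Lemma continuous_dotv {R : realType} (m : 'rV[R]_2) : continuous (dotv m).
Proof.
have -> : dotv m = fun p => m 0 0 * p 0 0 + m 0 1 * p 0 1.
  by apply/funext => p; exact: dotvE.
move=> p.
have cc i : {for p, continuous (fun q : 'rV[R]_2 => m 0 i * q 0 i)}.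
  apply: (@continuousM _ _ (fun=> m 0 i) (fun q : 'rV[R]_2 => q 0 i));
    [exact: cst_continuous | exact: coord_continuous].
by apply: (@continuousD _ _ _ (fun q : 'rV[R]_2 => m 0 0 * q 0 0)); exact: cc.
Qed.

Lemma is_derive_scaled {R : realType} (q : 'rV[R]_2 -> R) (p u : 'rV[R]_2) (a l : R) :
  is_derive p u q l -> is_derive p (a *: u) q (a * l).
Proof.
move=> /is_derive_line du; apply/is_derive_line.
have -> : (fun h : R => q (p + h *: (a *: u))) =
    (fun h : R => q (p + h *: u)) \o (fun h : R => a * h).
  by apply/funext => h /=; rewrite scalerA mulrC.
have da : is_derive (0:R) 1 (fun h : R => a * h) a.
  rewrite -[X in is_derive _ _ _ X](mulr1 a).
  exact: is_deriveZ.
rewrite mulrC; apply: is_derive1_comp. rewrite mulr0. exact: du.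
Qed.

(** A partial derivative along u at one point and a continuous one along v are
enough for the directional derivative to be linear in the direction: the
increment is split at p + h a u, and the mean value theorem along v turns the
second part into a value of g near p. *)
Lemma is_derive_combination {R : realType} (q g : 'rV[R]_2 -> R) (p u v : 'rV[R]_2) (a b l : R) :
  (forall p, is_derive p v q (g p)) -> {for p, continuous g} ->
  is_derive p u q l -> is_derive p (a *: u + b *: v) q (a * l + b * g p).
Proof.
move=> dv cg /(is_derive_scaled a) [du1 du2].
have {du1 du2} du : h^-1 *: ((q \o shift p) (h *: (a *: u)) - q p) @[h --> 0^'] --> a * l.
  by rewrite -du2; exact: du1.
apply: cvg_is_derive; apply/cvgrPdist_le => e e0.
have e2 : 0 < e / 2 by rewrite divr_gt0.
move/cvgrPdist_le : du => /(_ _ e2) du.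
have cp : p + z.1 *: (a *: u) + z.2 *: v @[z --> ((0:R), (0:R))] -->
    p + 0 *: (a *: u) + 0 *: v.
  apply: cvgD; first apply: cvgD; first exact: cvg_cst.
    by apply: cvgZr_tmp; exact: cvg_fst.
  by apply: cvgZr_tmp; exact: cvg_snd.
rewrite !scale0r !addr0 in cp.
have cc : b * g (p + z.1 *: (a *: u) + z.2 *: v) @[z --> ((0:R), (0:R))] --> b * g p.
  apply: cvgM; first exact: cvg_cst.
  by apply: (@cvg_comp _ _ _ (fun z : R * R => p + z.1 *: (a *: u) + z.2 *: v) g _ (nbhs p)); last exact: cg.
(* xi depends on h, so the limit is taken in the two variables separately. *)
move/cvgrPdist_le : cc => /(_ _ e2) [[A B] /= [nA nB] AB].
move/nbhs_ballP : nB => [d /= d0 dB].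
near=> h.
have h0 : h != 0 by near: h; exact: nbhs_dnbhs_neq.
have [xi xib X] := directional_MVT (p + h *: (a *: u)) (h * b) dv.
have -> : h^-1 * (q (p + h *: (a *: u + b *: v)) - q p) =
   h^-1 *: ((q \o shift p) (h *: (a *: u)) - q p) + b * g (p + h *: (a *: u) + xi *: v).
  rewrite scalerDr addrA [h *: (b *: v)]scalerA.
  rewrite -[in LHS](subrK (q (p + h *: (a *: u))) (q _)) X /= (addrC _ p).
  rewrite /GRing.scale/=. by field.
have h1 : `|a * l - h^-1 *: ((q \o shift p) (h *: (a *: u)) - q p)| <= e / 2.
  by near: h; exact: du.
have h2 : `|b * g p - b * g (p + h *: (a *: u) + xi *: v)| <= e / 2.
  apply: (AB (h, xi)); split => /=.
    by near: h; exact: nbhs_dnbhs.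
  apply: dB; rewrite -ball_normE/= sub0r normrN (le_lt_trans xib)//.
  near: h.
  have hb0 : h * b @[h --> (0 : R)^'] --> (0 * b : R).
    by apply: cvgMr_tmp; apply: cvg_within_filter; exact: cvg_id.
  by rewrite mul0r in hb0; move/cvgr0Pnorm_lt : hb0; exact.
rewrite opprD addrACA (splitr e) (le_trans (ler_normD _ _))// lerD//.
Unshelve. all: by end_near. Qed.

(** Q is constant on each line with direction a, and each such line enters the
half-plane where Q vanishes. *)
Lemma eq0_of_derive0 {R : realType} (Q : 'rV[R]_2 -> R) (m a : 'rV[R]_2) (B : R) :
  (forall p, is_derive p a Q 0) -> vanishes_past m B Q -> 0 < dotv m a ->
  forall p, Q p = 0.
Proof.
move=> dQ vQ ma p.
pose t := (B - dotv m p) / dotv m a + 1.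
have [xi _] := directional_MVT p t dQ.
rewrite mulr0 vQ ?sub0r; first by move/eqP; rewrite oppr_eq0 => /eqP.
rewrite dotvDZ /t mulrDl divfK ?gt_eqF// mul1r; lra.
Qed.

(** * Ray integrals *)

Lemma patch_ray {R : realType} (g : 'rV[R]_2 -> R) (m w q : 'rV[R]_2) (B L : R) :
  vanishes_past m B g -> 0 < dotv m w -> B < dotv m q + L * dotv m w ->
  (fun t : R => g (q + t *: w)) \_ `[0, +oo[ =
  (fun t : R => g (q + t *: w)) \_ `[0, L].
Proof.
move=> vg mw BL; apply/funext => t; rewrite !patchE !mem_setE !in_itv/= andbT.
have [t0|//] := leP 0 t; have [//|Lt] := leP t L.
rewrite vg// dotvDZ (lt_trans BL)// ltrD2l ltr_pM2r//.
Qed.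

Lemma ray_integral_segment {R : realType} (g : 'rV[R]_2 -> R) (m w q : 'rV[R]_2)
    (B L : R) :
  vanishes_past m B g -> 0 < dotv m w -> B < dotv m q + L * dotv m w ->
  ray_integral g w q = \int[lebesgue_measure]_(t in `[0, L]) g (q + t *: w).
Proof.
move=> vg mw BL.
by rewrite /ray_integral Rintegral_mkcond (patch_ray vg mw BL) -Rintegral_mkcond.
Qed.

Lemma exists_segment {R : realType} (m w q : 'rV[R]_2) (B : R) : 0 < dotv m w ->
  exists2 L : R, 0 <= L & B < dotv m q + L * dotv m w.
Proof.
move=> mw; exists (`|(B - dotv m q) / dotv m w| + 1); first by rewrite addr_ge0.
rewrite -ltrBlDl -ltr_pdivrMr// (le_lt_trans (ler_norm _))// ltrDl//.
Qed.

Lemma integrable_ray {R : realType} (g : 'rV[R]_2 -> R) (m w q : 'rV[R]_2) (B : R) :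
  continuous g -> vanishes_past m B g -> 0 < dotv m w ->
  lebesgue_measure.-integrable `[0, +oo[ (EFin \o (fun t : R => g (q + t *: w))).
Proof.
move=> cg vg mw; have [L L0 BL] := exists_segment q B mw.
rewrite integrable_mkcond// restrict_EFin (patch_ray vg mw BL) -restrict_EFin.
rewrite -integrable_mkcond//.
by apply: continuous_integrable_segment; exact: continuous_along_ray.
Qed.

Lemma near_exists_segment {R : realType} (m w q : 'rV[R]_2) (B L : R) :
  B < dotv m q + L * dotv m w -> \forall p \near q, B < dotv m p + L * dotv m w.
Proof.
rewrite -ltrBlDr => BL.
have H : \forall p \near q, B - L * dotv m w < dotv m p.
  exact: cvgr_gt (dotv m q) (@continuous_dotv R m q) _ BL.
by apply: filterS H => p; rewrite -ltrBlDr.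
Qed.

(** Near p all the rays leave the support of g before the same length L, so this
is continuity of an integral over a fixed segment. *)
Lemma continuous_ray_integral {R : realType} (g : 'rV[R]_2 -> R) (m w : 'rV[R]_2) (B : R) :
  continuous g -> vanishes_past m B g -> 0 < dotv m w ->
  continuous (ray_integral g w).
Proof.
move=> cg vg mw p; have [L L0 BL] := exists_segment p B mw.
apply/(@cvgrPdist_le _ _ _ (nbhs p) (nbhs_filter p)) => e e0.
(* Dividing by L + 1 rather than L allows L = 0. *)
have L1 : 0 < L + 1 by rewrite ltr_wpDl.
have e1 : 0 < e / (L + 1) by rewrite divr_gt0.
near=> q.
rewrite (ray_integral_segment vg mw BL) (@ray_integral_segment _ g m w q B L)//;
  last by near: q; exact: near_exists_segment.
rewrite (@le_trans _ _ (e / (L + 1) * L))//; last first.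
  by rewrite mulrAC ler_pdivrMr// ler_pM2l// lerDl.
apply: dist_Rintegral_segment => //; try exact: continuous_along_ray.
move=> t tL; rewrite distrC; move: t tL; near: q.
exact: near_ray_uniform.
Unshelve. all: by end_near. Qed.

Lemma vanishes_ray_integral {R : realType} (g : 'rV[R]_2 -> R) (m w : 'rV[R]_2) (B : R) :
  vanishes_past m B g -> 0 <= dotv m w -> vanishes_past m B (ray_integral g w).
Proof.
move=> vg mw q Bq; rewrite /ray_integral.
rewrite (@eq_Rintegral _ _ _ _ _ (cst 0)); first by rewrite Rintegral_cst// mul0r.
move=> t; rewrite inE/= in_itv/= andbT => t0.
by rewrite vg// dotvDZ (lt_le_trans Bq)// lerDl mulr_ge0.
Qed.

(** By the mean value theorem the difference quotients of h are values of k at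
nearby points, so they converge to k uniformly on the segment that carries the
integrals. *)
Lemma is_derive_under_ray {R : realType} (h k : 'rV[R]_2 -> R) (m u w p : 'rV[R]_2) (B : R) :
  continuous h -> continuous k -> (forall q, is_derive q u h (k q)) ->
  vanishes_past m B h -> vanishes_past m B k -> 0 < dotv m w ->
  is_derive p u (ray_integral h w) (ray_integral k w p).
Proof.
move=> ch ck dh vh vk mw; have [L L0 BL] := exists_segment p B mw.
apply: cvg_is_derive; apply/cvgrPdist_le => e e0.
(* Dividing by L + 1 rather than L allows L = 0. *)
have L1 : 0 < L + 1 by rewrite ltr_wpDl.
have e1 : 0 < e / (L + 1) by rewrite divr_gt0.
have cpu : {for (0:R), continuous (fun x : R => p + x *: u)}.
  by apply: cvgD; [exact: cvg_cst | apply: cvgZr_tmp; exact: cvg_id].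
have pE : p + 0 *: u = p by rewrite scale0r addr0.
have : \forall x \near (0 : R), forall t, t \in `[0, L] ->
    `|k (p + x *: u + t *: w) - k (p + t *: w)| <= e / (L + 1).
  have H : nbhs (p + 0 *: u) [set q | forall t, t \in `[0, L] ->
      `|k (q + t *: w) - k (p + t *: w)| <= e / (L + 1)].
    by rewrite pE; exact: near_ray_uniform.
  exact: cpu H.
move/nbhs_ballP => [d /= d0 dP].
have Bnear : \forall x \near (0 : R), B < dotv m (p + x *: u) + L * dotv m w.
  have H : nbhs (p + 0 *: u) [set q | B < dotv m q + L * dotv m w].
    by rewrite pE; exact: near_exists_segment.
  exact: cpu H.
near=> x.
have x0 : x != 0 by near: x; exact: nbhs_dnbhs_neq.
have xd : `|x| < d by near: x; exact: dnbhs0_lt.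
have Bx : B < dotv m (p + x *: u) + L * dotv m w.
  by near: x; exact: nbhs_dnbhs.
rewrite (ray_integral_segment vh mw Bx) (ray_integral_segment vh mw BL).
rewrite (ray_integral_segment vk mw BL).
have ci q : lebesgue_measure.-integrable `[0, L] (EFin \o (fun t : R => h (q + t *: w))).
  by apply: continuous_integrable_segment; exact: continuous_along_ray.
have chq q : continuous (fun t : R => h (q + t *: w)) by exact: continuous_along_ray.
have cd : continuous (fun t : R => h (p + x *: u + t *: w) - h (p + t *: w)).
  by move=> t; apply: cvgB; exact: chq.
rewrite -RintegralB// -RintegralZl//; last exact: continuous_integrable_segment.
rewrite (@le_trans _ _ (e / (L + 1) * L))//; last first.
  by rewrite mulrAC ler_pdivrMr// ler_pM2l// lerDl.
apply: dist_Rintegral_segment => //; first exact: continuous_along_ray.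
  by move=> t; apply: cvgMl_tmp; exact: cd.
move=> t tL; have [xi xix E] := directional_MVT (p + t *: w) x dh.
rewrite addrAC E mulrA mulVf// mul1r distrC addrAC.
by apply: dP => //; rewrite -ball_normE/= sub0r normrN (le_lt_trans xix).
Unshelve. all: by end_near. Qed.

Lemma exists_primitive {R : realType} (phi : R -> R) (a : R) : continuous phi ->
  exists Phi : R -> R, forall x, a < x -> is_derive x 1 Phi (phi x).
Proof.
move=> cphi; exists (fun x => \int[lebesgue_measure]_(t in `[a, x]) phi t) => x ax.
have [] := @continuous_FTC1_closed R phi a x (x + 1) _ _ ax (cphi x).
- by rewrite ltrDl.
- exact: continuous_integrable_segment.
- by move=> d1 d2; apply: DeriveDef => //; rewrite -d2 derive1E.
Qed.

(** Moving the vertex by h along the ray removes the initial piece of length h.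
With a primitive Phi of t |-> g (p + t w), the ray integral at p + h w is
Phi (h + L) - Phi h as soon as L is beyond the support, which also replaces an
invariance argument for the integral under translation. *)
Lemma is_derive_along_ray {R : realType} (g : 'rV[R]_2 -> R) (m w p : 'rV[R]_2) (B : R) :
  continuous g -> vanishes_past m B g -> 0 < dotv m w ->
  is_derive p w (ray_integral g w) (- g p).
Proof.
move=> cg vg mw; apply/is_derive_line.
have [L L0 BL] := exists_segment p B mw.
pose phi t := g (p + t *: w).
have cphi : continuous phi by exact: continuous_along_ray.
have [Phi dPhi] := exists_primitive (-1) cphi.
(* The fixed upper end is one unit beyond L, so that rays with vertex p + h w, |h| < 1, are covered. *)
have L2 : 0 < L + 1 by rewrite ltr_wpDl.
have phiL : phi (L + 1) = 0.
  rewrite /phi vg// dotvDZ (lt_le_trans BL)// lerD2l ler_pM2r// lerDl//.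
have -> : - g p = phi (L + 1) - phi 0.
  by rewrite phiL /phi scale0r addr0 sub0r.
(* The primitive starts at -1 so that it is differentiable on both sides of 0. *)
have shiftD (c y : R) : -1 < y + c -> is_derive y 1 (fun h : R => Phi (h + c)) (phi (y + c)).
  move=> yc; rewrite -[X in is_derive _ _ _ X]mulr1.
  apply: (@is_derive1_comp _ Phi (shift c)); last exact: is_derive_shift.
  exact: dPhi.
apply: (@near_eq_is_derive _ _ _ (fun h : R => Phi (h + (L + 1)) - Phi (h + 0))); last first.
  have d1 : is_derive (0 : R) 1 (fun h : R => Phi (h + (L + 1))) (phi (L + 1)).
    rewrite -[in phi _](add0r (L + 1)).
    by apply: shiftD; rewrite add0r (lt_trans _ L2)// oppr_lt0.
  have d2 : is_derive (0 : R) 1 (fun h : R => Phi (h + 0)) (phi 0).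
    rewrite -[in phi _](addr0 0).
    by apply: shiftD; rewrite addr0 oppr_lt0.
  exact: (is_deriveB d1 d2).
near=> h.
have h1 : `|h| < 1 by near: h; exact: (@cvgr0_norm_lt R R R).
have hN1 : -1 < h by move: h1; rewrite ltr_norml => /andP[].
have BLh : B < dotv m (p + h *: w) + (L + 1) * dotv m w.
  rewrite dotvDZ -addrA -mulrDl (lt_le_trans BL)// lerD2l ler_pM2r//; lra.
rewrite (ray_integral_segment vg mw BLh).
have gE t : g (p + h *: w + t *: w) = phi (t + h).
  by rewrite /phi -addrA -scalerDl (addrC h).
under eq_Rintegral do rewrite gE.
have D (y : R) : 0 <= y -> is_derive y 1 (fun t : R => Phi (t + h)) (phi (y + h)).
  by move=> y0; apply: shiftD; lra.
have C (y : R) : 0 <= y -> {for y, continuous (fun t : R => Phi (t + h))}.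
  move=> /D [dy _]; exact/differentiable_continuous/derivable1_diffP.
rewrite /Rintegral (@continuous_FTC2 _ _ (fun t : R => Phi (t + h)))//=.
- by rewrite addr0 add0r (addrC h).
- apply: continuous_subspaceT => t.
  apply: (@cvg_comp _ _ _ (fun t : R => t + h) phi _ (nbhs (t + h))); last exact: cphi.
  by apply: cvgD; [exact: cvg_id | exact: cvg_cst].
- split.
  + move=> y; rewrite in_itv/= => /andP[y0 _].
    by have [] := D y (ltW y0).
  + exact/cvg_at_right_filter/C.
  + by apply/cvg_at_left_filter/C; exact: ltW.
- move=> y; rewrite in_itv/= => /andP[y0 _].
  by have [_ <-] := D y (ltW y0); rewrite derive1E.
Unshelve. all: by end_near. Qed.

(** * The integral of the transform along the weighted axis *)

Lemma ray_integralN {R : realType} (g : 'rV[R]_2 -> R) (m w q : 'rV[R]_2) (B : R) :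
  continuous g -> vanishes_past m B g -> 0 < dotv m w ->
  ray_integral (fun p => - g p) w q = - ray_integral g w q.
Proof.
move=> cg vg mw; rewrite /ray_integral -mulN1r -RintegralZl//; last exact: integrable_ray vg mw.
by apply: eq_Rintegral => t _; rewrite mulN1r.
Qed.

Lemma continuous_weighted_vline {R : realType} (u v m n : 'rV[R]_2) (cu cv B C : R)
    (f : 'rV[R]_2 -> R) : continuous f ->
  vanishes_past m B f -> vanishes_past n C f -> 0 < dotv m u -> 0 < dotv n v ->
  continuous (weighted_vline u v cu cv f).
Proof.
move=> cf vm vn mu nv p; apply: (@continuousD _ _ _ (fun q => cv * ray_integral f v q)
    (fun q => cu * ray_integral f u q)).
  apply: (@continuousM _ _ (fun=> cv)); first exact: cst_continuous.
  exact: continuous_ray_integral cf vn nv p.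
apply: (@continuousM _ _ (fun=> cu)); first exact: cst_continuous.
exact: continuous_ray_integral cf vm mu p.
Qed.

Lemma vanishes_weighted_vline {R : realType} (u v m : 'rV[R]_2) (cu cv B : R)
    (f : 'rV[R]_2 -> R) :
  vanishes_past m B f -> 0 <= dotv m u -> 0 <= dotv m v ->
  vanishes_past m B (weighted_vline u v cu cv f).
Proof.
move=> vf mu mv q Bq; rewrite /weighted_vline.
by rewrite (vanishes_ray_integral vf mu)// (vanishes_ray_integral vf mv)// !mulr0 addr0.
Qed.

(** The key identity F = N Q.  The vectors m and n are the basis dual to (u, v),
so that dotv m and dotv n are the coordinates along u and along v.  Both sides
have derivative - weighted_vline along the axis, and both vanish when the
coordinate along u, which increases along the axis, is large. *)
Lemma ray_integral_weighted_vline {R : realType} (u v m n : 'rV[R]_2)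
    (cu cv B C N : R) (f : 'rV[R]_2 -> R) : continuous f ->
  vanishes_past m B f -> vanishes_past n C f ->
  dotv m u = 1 -> dotv m v = 0 -> dotv n u = 0 -> dotv n v = 1 ->
  0 < cv -> 0 < N ->
  forall p, ray_integral (weighted_vline u v cu cv f)
      (N^-1 *: weighted_sum u v cu cv) p =
    N * ray_integral (ray_integral f u) v p.
Proof.
move=> cf vm vn mu mv nu nv cv0 N0.
pose alpha := (N^-1 * cv) *: u + (N^-1 * cu) *: v.
have -> : N^-1 *: weighted_sum u v cu cv = alpha.
  by rewrite /alpha /weighted_sum scalerDr !scalerA addrC.
have mu0 : 0 < dotv m u by rewrite mu.
have nv0 : 0 < dotv n v by rewrite nv.
have malpha : 0 < dotv m alpha.
  suff -> : dotv m alpha = N^-1 * cv by rewrite mulr_gt0// invr_gt0.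
  rewrite /alpha dotvDZ mv mulr0 addr0 -[_ *: u]add0r dotvDZ mu mulr1.
  by rewrite dotvE !mxE !mulr0 !add0r.
pose Tf := weighted_vline u v cu cv f; pose Gu := ray_integral f u.
pose F := ray_integral Tf alpha; pose Q := ray_integral Gu v.
have cGu : continuous Gu := continuous_ray_integral cf vm mu0.
have cTf : continuous Tf := continuous_weighted_vline cf vm vn mu0 nv0.
have vTf : vanishes_past m B Tf.
  by apply: vanishes_weighted_vline; rewrite ?mu ?mv.
have vGu : vanishes_past n C Gu by apply: vanishes_ray_integral; rewrite ?nu.
have dQv p : is_derive p v Q (- Gu p) := is_derive_along_ray p cGu vGu nv0.
have dQu p : is_derive p u Q (- ray_integral f v p).
  rewrite -(ray_integralN p cf vn nv0).
  apply: (is_derive_under_ray p cGu _ _ vGu _ nv0).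
  - by move=> q; apply: (@continuousN _ _ _ f); exact: cf.
  - by move=> q; exact: is_derive_along_ray cf vm mu0.
  - by move=> q Cq; rewrite vn// oppr0.
have dF p : is_derive p alpha F (- Tf p) := is_derive_along_ray p cTf vTf malpha.
have dQ p : is_derive p alpha Q (- (N^-1 * Tf p)).
  have cNGu : {for p, continuous (fun q => - Gu q)} by apply: continuousN; exact: cGu.
  have := is_derive_combination (N^-1 * cv) (N^-1 * cu) dQv cNGu (dQu p).
  by congr is_derive; rewrite /Tf /weighted_vline /Gu; ring.
have dFQ p : is_derive p alpha (F - N \*: Q) 0.
  have -> : 0 = - Tf p - N *: - (N^-1 * Tf p) :> R.
    rewrite /GRing.scale/=; field; exact: lt0r_neq0.
  exact: is_deriveB.
have vFQ : vanishes_past m B (F - N \*: Q).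
  move=> q Bq; rewrite -[LHS]/(F q - N * Q q) /F.
  rewrite (vanishes_ray_integral vTf (ltW malpha) Bq).
  have vQ : vanishes_past m B Q.
    apply: vanishes_ray_integral; rewrite ?mv//.
    by apply: vanishes_ray_integral; rewrite ?mu.
  by rewrite vQ// mulr0 subrr.
move=> p; apply/eqP; rewrite -subr_eq0; apply/eqP.
exact: (eq0_of_derive0 dFQ vFQ malpha p).
Qed.

(** * The dual basis, the support and the angle *)

Lemma exists_dual {R : realType} (u v : 'rV[R]_2) :
  u 0 0 * v 0 1 - u 0 1 * v 0 0 != 0 ->
  exists2 m : 'rV[R]_2, dotv m u = 1 & dotv m v = 0.
Proof.
set D := (X in X != 0) => D0.
exists (\row_i (if i == 0 then v 0 1 / D else - v 0 0 / D)).
  by rewrite dotvE !mxE/= /D; field.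
by rewrite dotvE !mxE/=; ring.
Qed.

Lemma compact_vanishes_past {R : realType} (f : 'rV[R]_2 -> R) (m : 'rV[R]_2) :
  compactly_supported f -> exists B, vanishes_past m B f.
Proof.
move=> csf.
have /compact_bounded [M [Mr MP]] : compact (dotv m @` closure [set p | f p != 0]).
  apply: continuous_compact => //; apply: continuous_subspaceT.
  exact: continuous_dotv.
(* Boundedness provides a bound for each real above M only. *)
exists (M + 1) => q Mq; apply/eqP; apply: contraTT Mq => fq; rewrite -leNgt.
apply: (le_trans (ler_norm _)); apply: MP; first by rewrite ltrDl.
by exists q => //; exact: subset_closure.
Qed.

Lemma enorm1 {R : realType} (u : 'rV[R]_2) : enorm u = 1 -> dotv u u = 1.
Proof.
rewrite /enorm => h; rewrite -[LHS]sqr_sqrtr ?h ?expr1n// dotvE.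
by rewrite addr_ge0// -expr2 sqr_ge0.
Qed.

(** The angle is an arccosine, so its cosine is the inner product once that lies
between -1 and 1; this follows from Lagrange's identity, which expresses
1 - (u . v)^2 as the square of the determinant. *)
Lemma cos_angle {R : realType} (u v : 'rV[R]_2) : enorm u = 1 -> enorm v = 1 ->
  cos (angle u v) = dotv u v.
Proof.
move=> hu hv; rewrite /angle hu hv mulr1 divr1 acosK// in_itv/= -ler_norml.
rewrite -(@ler_pXn2r _ 2)// ?nnegrE// expr1n real_normK ?num_real//.
have := enorm1 hu; have := enorm1 hv; rewrite !dotvE => hv' hu'.
have -> : 1 = (u 0 0 * v 0 0 + u 0 1 * v 0 1) ^+ 2 + (u 0 0 * v 0 1 - u 0 1 * v 0 0) ^+ 2.
  transitivity ((u 0 0 * u 0 0 + u 0 1 * u 0 1) * (v 0 0 * v 0 0 + v 0 1 * v 0 1)).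
    by rewrite hu' hv' mulr1.
  ring.
by rewrite lerDl sqr_ge0.
Qed.

(** * The splitting of the angle *)

(** Expanding sin b.2 = sin (2 beta - b.1) turns the ratio condition into
K sin b.1 = S cos b.1, where K = cu + cv cos (2 beta) and
S = cv sin (2 beta); with N^2 = K^2 + S^2 and S and sin b.1 positive, this makes
(N, b.1) the polar coordinates of (K, S). *)
Lemma splits_angle_cos_sin {R : realType} (beta cu cv N : R) (b : R * R) :
  0 < 2 * beta < pi -> cu != 0 -> 0 < cv -> 0 < N ->
  N ^+ 2 = (cu + cv * cos (2 * beta)) ^+ 2 + (cv * sin (2 * beta)) ^+ 2 ->
  splits_angle beta cu cv b ->
  N * cos b.1 = cu + cv * cos (2 * beta) /\ N * sin b.1 = cv * sin (2 * beta).
Proof.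
move=> hb cu0 cv0 N0 NE [b1 _ bE sE].
have s0 : 0 < sin (2 * beta) := sin_gt0_pi hb.
have s1 : 0 < sin b.1 := sin_gt0_pi b1.
have S0 : 0 < cv * sin (2 * beta) by rewrite mulr_gt0.
have sb2 : sin b.2 != 0.
  (* Division by 0 gives 0, whereas cv / cu is not 0. *)
  apply/eqP => z; move: sE; rewrite z invr0 mulr0 => /esym/eqP.
  by rewrite mulf_eq0 invr_eq0 (negbTE cu0) gt_eqF.
have E : (cu + cv * cos (2 * beta)) * sin b.1 = cv * sin (2 * beta) * cos b.1.
  have : sin b.1 * cu = cv * sin b.2.
    by move/eqP: sE; rewrite eqr_div// => /eqP.
  have -> : b.2 = 2 * beta - b.1 by rewrite -bE addrAC subrr add0r.
  by rewrite sinB => E; rewrite mulrDl [cu * _]mulrC E; ring.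
have NS : N * sin b.1 = cv * sin (2 * beta).
  apply/eqP; rewrite -(@eqrXn2 _ 2)//; try by rewrite ltW// mulr_gt0.
  rewrite exprMn NE mulrDl -[X in X + _]exprMn E; apply/eqP.
  transitivity ((cv * sin (2 * beta)) ^+ 2 * (cos b.1 ^+ 2 + sin b.1 ^+ 2)).
    by ring.
  by rewrite cos2Dsin2 mulr1.
split=> //; apply: (mulIf (lt0r_neq0 s1)).
by rewrite mulrAC NS -E.
Qed.

(** The witness is the argument acos (K / N) of the point (K, S), where
K = cu + cv cos (2 beta) and S = cv sin (2 beta). *)
Lemma exists_splits_angle {R : realType} (beta cu cv N : R) :
  0 < 2 * beta < pi -> cu != 0 -> 0 < cv -> 0 < N ->
  N ^+ 2 = (cu + cv * cos (2 * beta)) ^+ 2 + (cv * sin (2 * beta)) ^+ 2 ->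
  exists b, splits_angle beta cu cv b.
Proof.
move=> hb cu0 cv0 N0 NE.
have s0 : 0 < sin (2 * beta) := sin_gt0_pi hb.
have S0 : 0 < cv * sin (2 * beta) by rewrite mulr_gt0.
pose K := cu + cv * cos (2 * beta).
have KN : -1 < K / N < 1.
  rewrite -ltr_norml -(@ltr_pXn2r _ 2)// ?nnegrE// expr1n real_normK ?num_real//.
  rewrite expr_div_n ltr_pdivrMr ?exprn_gt0// mul1r NE ltrDl exprn_gt0//.
have KN' : -1 <= K / N <= 1 by case/andP: KN => /ltW -> /ltW ->.
have cb : cos (acos (K / N)) = K / N by rewrite acosK// in_itv.
have sb : sin (acos (K / N)) = cv * sin (2 * beta) / N.
  rewrite sin_acos//.
  have -> : 1 - (K / N) ^+ 2 = (cv * sin (2 * beta) / N) ^+ 2.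
    rewrite !expr_div_n -[X in X - _](@divff _ (N ^+ 2)) ?expf_neq0 ?gt_eqF//.
    by rewrite -mulrBl NE addrAC subrr add0r.
  by rewrite sqrtr_sqr ger0_norm// divr_ge0// ltW.
set b1 := acos (K / N) in cb sb.
have b10 : 0 < b1 by rewrite acos_gt0//; case/andP: KN' => ->; case/andP: KN.
have b1pi : b1 < pi by rewrite acos_ltpi//; case/andP: KN' => _ ->; case/andP: KN => ->.
have sb2 : sin (2 * beta - b1) = cu * sin (2 * beta) / N.
  by rewrite sinB cb sb /K; field; exact: lt0r_neq0.
have sb20 : sin (2 * beta - b1) != 0.
  by rewrite sb2 !mulf_neq0// ?invr_eq0 gt_eqF.
exists (b1, 2 * beta - b1); split => /=.
- by rewrite b10 b1pi.
- case/andP: hb => hb0 hbpi; apply/andP; split.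
    rewrite normr_gt0; apply: contraNneq sb20 => ->; by rewrite sin0.
  by rewrite ltr_norml; apply/andP; split; lra.
- by rewrite addrC subrK.
- by rewrite sb sb2; field; rewrite cu0 !gt_eqF.
Qed.

(** * The inversion formula *)

Unset Implicit Arguments.
Set Strict Implicit.

Theorem theorem8 (R : realType) (u v : 'rV[R]_2) (beta cu cv : R)
    (f : 'rV[R]_2 -> R)
    (hu : enorm u = 1) (hv : enorm v = 1)
    (huv : free [:: u; v])
    (hangle : angle u v = 2 * beta) (hbeta : 0 < 2 * beta < pi)
    (hcu : cu != 0) (hcv : 0 < cv)
    (hf : continuous f) (hsupp : compactly_supported f) :
  let N := enorm (weighted_sum u v cu cv) in
  let alpha := weighted_axis u v cu cv in
  let Tf := weighted_vline u v cu cv f in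
  let F := fun p : 'rV[R]_2 =>
    \int[lebesgue_measure]_(t in `[0, +oo[) Tf (p + t *: alpha) in
  (forall p : 'rV[R]_2,
     [/\ lebesgue_measure.-integrable `[0, +oo[
           (EFin \o (fun t : R => Tf (p + t *: alpha))),
         derivable F p v,
         derivable ('D_v F) p u
       & f p = N^-1 * 'D_u ('D_v F) p]) /\
  (exists! b : R * R, splits_angle beta cu cv b) /\
  (forall b : R * R, splits_angle beta cu cv b ->
     N^-1 = sin b.1 / (cv * sin (2 * beta))).
Proof.
move=> N alpha Tf F.
have uvE : dotv u v = cos (2 * beta) by rewrite -hangle cos_angle.
have uu := enorm1 hu; have vv := enorm1 hv.
have s0 : 0 < sin (2 * beta) := sin_gt0_pi hbeta.
have S0 : 0 < cv * sin (2 * beta) by rewrite mulr_gt0.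
have sE : sin (2 * beta) ^+ 2 = dotv u u * dotv v v - dotv u v ^+ 2.
  by rewrite uu vv mulr1 uvE sin2cos2.
have N2 : N ^+ 2 = (cu + cv * cos (2 * beta)) ^+ 2 + (cv * sin (2 * beta)) ^+ 2.
  have -> : N ^+ 2 = dotv (weighted_sum u v cu cv) (weighted_sum u v cu cv).
    by rewrite /N /enorm sqr_sqrtr// dotvE addr_ge0// -expr2 sqr_ge0.
  have -> : dotv (weighted_sum u v cu cv) (weighted_sum u v cu cv) =
      cu ^+ 2 * dotv v v + cv ^+ 2 * dotv u u + 2 * cu * cv * dotv u v.
    by rewrite /weighted_sum !dotvE !mxE; ring.
  by rewrite exprMn sE uu vv uvE; ring.
have N0 : 0 < N.
  rewrite lt0r sqrtr_ge0 andbT -sqrf_eq0 N2.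
  by rewrite gt_eqF// ltr_wpDl ?sqr_ge0// exprn_gt0.
have D0 : u 0 0 * v 0 1 - u 0 1 * v 0 0 != 0.
  have : (u 0 0 * v 0 1 - u 0 1 * v 0 0) ^+ 2 != 0.
    have -> : (u 0 0 * v 0 1 - u 0 1 * v 0 0) ^+ 2 = sin (2 * beta) ^+ 2.
      by rewrite sE !dotvE; ring.
    by rewrite expf_neq0// gt_eqF.
  by rewrite expf_eq0.
have [m mu mv] := exists_dual D0.
have [n nv nu] : exists2 n : 'rV[R]_2, dotv n v = 1 & dotv n u = 0.
  apply: exists_dual; rewrite -oppr_eq0 opprB; move: D0.
  by rewrite (mulrC (v 0 1)) (mulrC (v 0 0)).
have [B vm] := compact_vanishes_past m hsupp.
have [C vn] := compact_vanishes_past n hsupp.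
have mu0 : 0 < dotv m u by rewrite mu.
have nv0 : 0 < dotv n v by rewrite nv.
split; last split.
- have FE : F = N \*: ray_integral (ray_integral f u) v.
    by apply/funext => p; exact: ray_integral_weighted_vline hf vm vn mu mv nu nv hcv N0 p.
  have cG := continuous_ray_integral hf vm mu0.
  have vG : vanishes_past n C (ray_integral f u).
    by apply: vanishes_ray_integral; rewrite ?nu.
  have dF p : is_derive p v F (N *: - ray_integral f u p).
    rewrite FE; apply: is_deriveZ; exact: is_derive_along_ray cG vG nv0.
  have DF : 'D_v F = N \*: (- ray_integral f u).
    by apply/funext => p; have [_ ->] := dF p.
  have dDF p : is_derive p u ('D_v F) (N *: - - f p).
    rewrite DF; apply: is_deriveZ; apply: is_deriveN.
    exact: is_derive_along_ray hf vm mu0.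
  move=> p; split.
  + have malpha : 0 < dotv m alpha.
      suff -> : dotv m alpha = N^-1 * cv by rewrite mulr_gt0// invr_gt0.
      rewrite /alpha /weighted_axis /weighted_sum -/N.
      transitivity (N^-1 * (cu * dotv m v + cv * dotv m u)).
        by rewrite !dotvE !mxE; ring.
      by rewrite mv mu mulr0 add0r mulr1.
    have vTf : vanishes_past m B Tf.
      by apply: vanishes_weighted_vline; rewrite ?mu ?mv.
    exact: integrable_ray (continuous_weighted_vline hf vm vn mu0 nv0) vTf malpha.
  + by have [] := dF p.
  + by have [] := dDF p.
  + have [_ ->] := dDF p.
    by rewrite opprK /GRing.scale/= mulKf// gt_eqF.
- have [b hb] := exists_splits_angle hbeta hcu hcv N0 N2.
  exists b; split => // b' hb'.
  have [cb _] := splits_angle_cos_sin hbeta hcu hcv N0 N2 hb.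
  have [cb' _] := splits_angle_cos_sin hbeta hcu hcv N0 N2 hb'.
  case: hb hb' => /andP[b10 b1pi] _ bE _ [/andP[b10' b1pi'] _ bE' _].
  have E1 : b.1 = b'.1.
    apply: cos_inj; rewrite ?in_itv/= ?(ltW b10) ?(ltW b1pi) ?(ltW b10') ?(ltW b1pi')//.
    by apply: (mulfI (lt0r_neq0 N0)); rewrite cb cb'.
  have E2 : b.2 = b'.2 by move: bE; rewrite -bE' E1 => /addrI.
  by rewrite (surjective_pairing b) E1 E2 -surjective_pairing.
- move=> b hb; have [_ <-] := splits_angle_cos_sin hbeta hcu hcv N0 N2 hb.
  have [/sin_gt0_pi sb _ _ _] := hb.
  by field; rewrite !gt_eqF.
Qed.
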